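(* Let $(X,\mathcal{E},\leq)$ be a linearly ordered connected coarse space. Then $\operatorname{asdim}(X,\mathcal{E})\in\{0,1\}$.
   Context: A coarse structure on a set $X$ is a family $\mathcal{E}$ of subsets of $X\times X$ (called entourages) such that: each $E\in\mathcal{E}$ contains the diagonal $\triangle_X=\{(x,x):x\in X\}$; if $E,E'\in\mathcal{E}$ then $E\circ E'\in\mathcal{E}$ and $E^{-1}\in\mathcal{E}$, where $E\circ E'=\{(x,y):\exists z\ ((x,z)\in E,\ (z,y)\in E')\}$ and $E^{-1}=\{(y,x):(x,y)\in E\}$; if $E\in\mathcal{E}$ and $\triangle_X\subseteq E'\subseteq E$ then $E'\in\mathcal{E}$. The pair $(X,\mathcal{E})$ is called a coarse space. For $x\in X$, $A\subseteq X$ and $E\in\mathcal{E}$, $E[x]=\{y\in X:(x,y)\in E\}$ and $E[A]=\bigcup_{a\in A}E[a]$. The coarse space is connected if for any $x,y\in X$ there is $E\in\mathcal{E}$ with $y\in E[x]$. A linear order $\leq$ on $X$ is compatible with $\mathcal{E}$ if one of the following equivalent conditions holds: (1) for every $E\in\mathcal{E}$ there exists $F\in\mathcal{E}$ such that if $x<y$ and $y\in X\setminus F[x]$ then $x'<y$ for each $x'\in E[x]$; (2) for every $E\in\mathcal{E}$ there exists $H\in\mathcal{E}$ such that if $y<x$ and $y\in X\setminus H[x]$ then $y<x'$ for each $x'\in E[x]$; (3) for every $E\in\mathcal{E}$ there exists $K\in\mathcal{E}$ such that if $x<y$ and $y\in X\setminus K[x]$ then $x'<y'$ for all $x'\in E[x]$,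 $y'\in E[y]$. A coarse space endowed with a linear order compatible with its coarse structure is called linearly ordered. Asymptotic dimension: for $E\in\mathcal{E}$, a family $\mathcal{A}$ of subsets of $X$ is $E$-bounded if for each $A\in\mathcal{A}$ there exists $x\in X$ with $A\subseteq E[x]$; it is $E$-disjoint if $E[A]\cap B=\emptyset$ for all distinct $A,B\in\mathcal{A}$. One writes $\operatorname{asdim}(X,\mathcal{E})\leq n$ if for each $E\in\mathcal{E}$ there exist $F\in\mathcal{E}$ and an $F$-bounded covering $\mathcal{M}$ of $X$ which can be partitioned as $\mathcal{M}=\mathcal{M}_0\cup\dots\cup\mathcal{M}_n$ so that each family $\mathcal{M}_i$ is $E$-disjoint. If there is a minimal natural number $n\geq 0$ with this property then $\operatorname{asdim}(X,\mathcal{E})=n$; otherwise $\operatorname{asdim}(X,\mathcal{E})=\infty$. *)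

(* Defs.v *)
From mathcomp Require Import all_boot all_order.
From mathcomp Require Import boolp classical_sets.

Set Implicit Arguments.
Unset Strict Implicit.
Unset Printing Implicit Defensive.

Local Open Scope order_scope.
Local Open Scope classical_set_scope.

(* The composite {(x, y) | exists z, (x, z) \in E /\ (z, y) \in E'} is written
   [E' \; E] in the library's relation_scope.  The family is not
   assumed nonempty; connectedness excludes the empty family unless X itself is
   empty. *)
Record coarse_structure (X : Type) := CoarseStructure {
  entourage : set (set (X * X));
  entourage_diagonal : forall E, entourage E -> diagonal `<=` E;
  entourage_comp : forall E E', entourage E -> entourage E' ->
    entourage (E' \; E)%relation;
  entourage_inv : forall E, entourage E -> entourage (E^-1)%relation;
  entourage_sub : forall E E', entourage E ->
    diagonal `<=` E' -> E' `<=` E -> entourage E'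
}.

(* E[x] is [xsection E x]. *)
Definition entourage_image (X : Type) (E : set (X * X)) (A : set X) : set X :=
  \bigcup_(a in A) xsection E a.

Definition coarse_connected (X : Type) (C : coarse_structure X) : Prop :=
  forall x y : X, exists2 E, entourage C E & xsection E x y.

Section CompatibleOrder.
Variables (d : Order.disp_t) (X : orderType d) (C : coarse_structure X).

Definition compatible_above : Prop :=
  forall E, entourage C E -> exists2 F, entourage C F &
    forall x y : X, x < y -> (~` xsection F x) y ->
    forall x', xsection E x x' -> x' < y.

Definition compatible_below : Prop :=
  forall E, entourage C E -> exists2 H, entourage C H &
    forall x y : X, y < x -> (~` xsection H x) y ->
    forall x', xsection E x x' -> y < x'.

Definition compatible_both : Prop :=
  forall E, entourage C E -> exists2 K, entourage C K &
    forall x y : X, x < y -> (~` xsection K x) y ->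
    forall x' y', xsection E x x' -> xsection E y y' -> x' < y'.

(* The three conditions are equivalent, so any one of them may be given. *)
Definition order_compatible : Prop :=
  [\/ compatible_above, compatible_below | compatible_both].

End CompatibleOrder.

Section AsymptoticDimension.
Variable X : Type.

Definition bounded_family (E : set (X * X)) (M : set (set X)) : Prop :=
  forall A, M A -> exists x, A `<=` xsection E x.

Definition disjoint_family (E : set (X * X)) (M : set (set X)) : Prop :=
  forall A B, M A -> M B -> A <> B -> entourage_image E A `&` B = set0.

(* The parts M_0, ..., M_n are pairwise disjoint as families of sets, and some
   of them may be empty, so that the property is monotone in n. *)
Definition asdim_le (C : coarse_structure X) (n : nat) : Prop :=
  forall E, entourage C E -> exists2 F, entourage C F &
    exists M : set (set X),
      [/\ bounded_family F M,
          \bigcup_(A in M) A = [set: X] &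
          exists Mi : 'I_n.+1 -> set (set X),
            [/\ M = \bigcup_i Mi i,
                trivIset [set: 'I_n.+1] Mi &
                forall i, disjoint_family E (Mi i)]].

(* [Some n] is a finite dimension, [None] is infinity. *)
Definition asdim (C : coarse_structure X) : option nat :=
  if pselect (exists n, `[< asdim_le C n >]) is left ex_n
  then Some (ex_minn ex_n) else None.

End AsymptoticDimension.

(* Main.v *)
Require Import Defs.
From mathcomp Require Import all_boot all_order.
From mathcomp Require Import boolp classical_sets.

(** Every entourage lies in an entourage [G] that is symmetric and order-convex:
    [(x, y) \in G] puts all pairs of points between [x] and [y] into [G]
    ([convex_entourage]; this is what compatibility of the order provides).
    It remains to cover [X] by two [G]-disjoint, [G]-bounded families.

    Cut [X] into its [G]-chain components; no two of them contain [G]-close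
    points.  Fix a base point [p] in each component.  The points [G]-close to
    [p] get level 0, the others one less than the number of steps of a shortest
    [G]-chain from [p].  By convexity, a ball around [p] in the chain metric is
    order-convex around [p], so that a component looks like a line marked off in
    steps of [G]: a sphere of positive level is the union of its parts below and
    above [p], each of them [G]-bounded, and the two parts are not
    [G]-close, since otherwise [p], lying between close points, would itself be
    close to them.  [G]-close points of one
    component have levels that differ by at most one.  Hence the blocks (the
    ball of level 0 and the two halves of every other sphere) are [G]-bounded
    ([block_bounded]), and two different blocks whose levels have the same
    parity are [G]-disjoint ([close_same_parity]).  The parity of the level
    splits the blocks into two families, so the dimension is at most 1. *)

Set Implicit Arguments.
Unset Strict Implicit.
Unset Printing Implicit Defensive.

Import Order.TTheory.
Local Open Scope order_scope.
Local Open Scope classical_set_scope.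

(** * Betweenness in a linear order *)

Section Betweenness.
Variables (d : Order.disp_t) (X : orderType d).
Implicit Types a b u x y z : X.

Definition between a x b : bool := (a <= x <= b) || (b <= x <= a).

Lemma between_sym a x b : between a x b = between b x a.
Proof. by rewrite /between orbC. Qed.

Lemma between_left a b : between a a b.
Proof. by rewrite /between !lexx /= andbT le_total. Qed.

Lemma between_right a b : between a b b.
Proof. by rewrite between_sym between_left. Qed.

Lemma between_le a x b : a <= b -> between a x b = (a <= x <= b).
Proof.
move=> ab; rewrite /between; apply/orP/idP => [[//|/andP[bx xa]]|]; last by left.
by rewrite (le_trans ab bx) (le_trans xa ab).
Qed.

Lemma between_split p u y z :
  between p u y -> between p u z \/ between z u y.
Proof.
rewrite /between => /orP[|] /andP[h1 h2]; case/orP: (le_total u z) => uz.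
- by left; rewrite h1 uz.
- by right; rewrite uz h2.
- by right; rewrite h1 uz orbT.
- by left; rewrite h2 uz orbT.
Qed.

Lemma between_same_side p y y' :
  (p < y) = (p < y') -> between p y y' \/ between p y' y.
Proof.
rewrite /between; case: (ltP p y) => py; case: (ltP p y') => py' // _;
  case/orP: (le_total y y') => ->; rewrite ?py ?py' ?(ltW py) ?(ltW py') ?orbT;
  by [left | right].
Qed.

Lemma between_opposite_sides p y y' :
  (p < y) != (p < y') -> between y p y'.
Proof.
rewrite /between; case: (ltP p y) => py; case: (ltP p y') => py' // _.
  by rewrite (ltW py) orbT.
by rewrite (ltW py').
Qed.

Lemma between_trans a b x y u :
  between a x b -> between a y b -> between x u y -> between a u b.
Proof.
wlog ab : a b / a <= b => [hw|].
  case/orP: (le_total a b) => [ab|ba]; first exact: hw.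
  by rewrite 3!(between_sym a); exact: hw.
wlog xy : x y / x <= y => [hw|].
  case/orP: (le_total x y) => [xy|yx]; first exact: hw.
  by move=> ax ay; rewrite between_sym; exact: hw.
rewrite !(between_le _ ab) (between_le _ xy).
move=> /andP[ax _] /andP[_ yb] /andP[xu uy].
by rewrite (le_trans ax xu) (le_trans uy yb).
Qed.

End Betweenness.

(** * Order-convex entourages *)

Section ConvexEntourage.
Variables (d : Order.disp_t) (X : orderType d) (C : coarse_structure X).
Implicit Types E F G : set (X * X).

Definition order_convex G : Prop :=
  forall x y u v, G (x, y) -> between x u y -> between x v y -> G (u, v).

Lemma entourage_refl E x : entourage C E -> E (x, x).
Proof. by move=> CE; apply: (entourage_diagonal CE). Qed.

Lemma compatible_both_above : compatible_both C -> compatible_above C.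
Proof.
move=> cB E CE; have [K CK KP] := cB E CE; exists K => // x y xy nK x' Ex'.
by apply: (KP x y) => //; apply/xsectionP; exact: entourage_refl.
Qed.

(** Which of the two ends is [F]-close to the points in between depends on the
    form in which compatibility is given: a form that controls the points above
    the centre of a ball settles the pair [(a, b)], a form that controls the
    points below it settles the reversed pair. *)
Lemma compatible_interval E : order_compatible C -> entourage C E ->
  exists2 F, entourage C F &
    forall a b x, E (a, b) -> a <= x <= b -> F (a, x) \/ F (b, x).
Proof.
move=> hC CE.
have {hC}[cA|cB] : compatible_above C \/ compatible_below C.
  by case: hC => [?|?|/compatible_both_above ?]; [left|right|left].
- have [F CF FP] := cA _ CE; exists F => // a b x Eab /andP[ax xb].
  left; apply: contrapT => nF.
  have ltax : a < x.
    rewrite lt_neqAle ax andbT; apply/eqP => eax; apply: nF.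
    by rewrite eax; exact: entourage_refl.
  have /(_ b) := FP a x ltax (fun h => nF (iffLR (xsectionP _ _ _) h)).
  by rewrite ltNge xb => /(_ (iffRL (xsectionP _ _ _) Eab)).
- have [F CF FP] := cB _ (entourage_inv CE).
  exists F => // a b x Eab /andP[ax xb].
  right; apply: contrapT => nF.
  have ltxb : x < b.
    rewrite lt_neqAle xb andbT; apply/eqP => exb; apply: nF.
    by rewrite exb; exact: entourage_refl.
  have /(_ a) := FP b x ltxb (fun h => nF (iffLR (xsectionP _ _ _) h)).
  by rewrite ltNge ax => /(_ (iffRL (xsectionP _ _ _) Eab)).
Qed.

(** The entourage is the set of pairs that lie between the two ends of a pair in
    a symmetric enlargement of [E].  It is controlled because both points of such
    a pair are close to the same end. *)
Lemma convex_entourage E : order_compatible C -> entourage C E ->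
  exists G, [/\ entourage C G, E `<=` G, order_convex G &
    forall x y, G (x, y) -> G (y, x)].
Proof.
move=> hC CE.
pose S := (E^-1 \; E)%relation.
have CS : entourage C S by apply: entourage_comp => //; exact: entourage_inv.
have Ssym a b : S (a, b) -> S (b, a) by move=> [z /= ? ?]; exists z.
have ES : E `<=` S.
  by move=> [a b] Eab; exists b => //=; exact: entourage_refl.
have [F CF FP] := compatible_interval hC CS.
pose H := (F \; S)%relation.
have CH : entourage C H by exact: entourage_comp.
have SH a b x : S (a, b) -> between a x b -> H (a, x).
  have end_or a' b' : S (a', b') -> F (a', x) \/ F (b', x) -> H (a', x).
    move=> Sab [Fax|Fbx]; last by exists b'.
    by exists a' => //=; exact: entourage_refl.
  move=> Sab /orP[axb|bxa]; apply: (end_or _ _ Sab); first exact: FP axb.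
  by have [?|?] := FP b a x (Ssym _ _ Sab) bxa; [right|left].
pose G : set (X * X) :=
  [set xy | exists a b, [/\ S (a, b), between a xy.1 b & between a xy.2 b]].
exists G; split.
- apply: (@entourage_sub _ _ (H \; H^-1)%relation).
  + by apply: entourage_comp => //; exact: entourage_inv.
  + move=> [x y] xy; have <- : x = y := xy.
    by exists x, x; split; rewrite ?between_left //; exact: entourage_refl.
  + by move=> [x y] [a [b [Sab /(SH _ _ _ Sab) ax /(SH _ _ _ Sab) ay]]]; exists a.
- move=> [x y] /ES Sxy; exists x, y; split => //=;
    [exact: between_left|exact: between_right].
- move=> x y u v [a [b [/= Sab ax ay]]] xu xv; exists a, b; split => //=;
    exact: between_trans ax ay _.
- by move=> x y [a [b [/= Sab ax ay]]]; exists a, b.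
Qed.

End ConvexEntourage.

(** * Blocks of a chain component *)

Section ChainBlocks.
Variables (d : Order.disp_t) (X : orderType d) (G : set (X * X)).
Hypotheses (Grefl : forall x, G (x, x)) (Gsym : forall x y, G (x, y) -> G (y, x)).
Hypothesis Gconvex : order_convex G.
Implicit Types p x y z : X.

(** The numbering starts with the whole [G]-ball around [p]: if [p] alone had
    level 0, the two sides of the sphere of level 1 could contain close points,
    whereas the ball is a single [G]-bounded block. *)
Fixpoint reach n p y : Prop :=
  if n is m.+1 then exists2 z, reach m p z & G (z, y) else G (p, y).

(** Along a chain from [p] to [y], some step must pass over [u]. *)
Lemma reach_between n p u y : reach n p y -> between p u y -> reach n p u.
Proof.
elim: n u y => [|n IH] u y /= => [Gpy puy|[z rz Gzy] /(between_split z)[pz|zy]].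
- by apply: (Gconvex Gpy) puy; exact: between_left.
- by exists u => //; exact: IH pz.
- by exists z => //; apply: (Gconvex Gzy) zy; exact: between_left.
Qed.

Definition sources y : pred X := fun p => `[< exists n, reach n p y >].

Lemma sources_self y : sources y y.
Proof. by apply/asboolP; exists 0%N; exact: Grefl. Qed.

(** [choose] depends only on the extension of the predicate, so that all points
    of a chain component get the same base point. *)
Definition base y : X := choose (sources y) y.

Lemma base_close y y' : G (y, y') -> base y = base y'.
Proof.
move=> Gyy'.
have sourcesE : sources y =1 sources y'.
  move=> p; apply/asboolP/asboolP => -[n r]; exists n.+1;
    [by exists y|by exists y' => //; exact: Gsym].
rewrite /base (eq_choose sourcesE); apply: choose_id; last exact: sources_self.
by rewrite -sourcesE; exact: sources_self.
Qed.

Lemma base_reaches y : exists n, `[< reach n (base y) y >].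
Proof.
have /asboolP[n r] := chooseP (sources_self y).
by exists n; apply/asboolP.
Qed.

Definition level y : nat := ex_minn (base_reaches y).

Lemma reach_level y : reach (level y) (base y) y.
Proof. by rewrite /level; case: ex_minnP => n /asboolP. Qed.

Lemma level_le n y : reach n (base y) y -> (level y <= n)%N.
Proof. by move=> /asboolP r; rewrite /level; case: ex_minnP => m _; apply. Qed.

Lemma level_close y y' : G (y, y') -> (level y' <= (level y).+1)%N.
Proof.
move=> Gyy'; apply: level_le; exists y => //.
by rewrite -(base_close Gyy'); exact: reach_level.
Qed.

Definition block_key y : X * nat * bool :=
  (base y, level y, (0 < level y)%N && (base y < y)).

Definition block y : set X := [set y' | block_key y' = block_key y].

(** Of two points of a half sphere of positive level around [p], one lies between
    [p] and the other: say [y] lies between [p] and [y'].  Let [z] be the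
    last but one point of a shortest chain from [p] to [y'].  Then [y] is not
    between [p] and [z], for it would be of lower level; so it is between the
    close points [z] and [y']. *)
Lemma block_close y y' : block_key y = block_key y' -> (0 < level y)%N ->
  G (y, y').
Proof.
move=> [eb el es] lt0; move: es; rewrite -el lt0 /= => es.
have mid x x' : base x = base x' -> level x = level x' -> (0 < level x)%N ->
    between (base x) x x' -> G (x, x').
  move=> exb exl xgt0 xb; have := reach_level x'.
  rewrite -exb -exl; case elx : (level x) xgt0 => [//|n] _ /= [z rz Gzx'].
  have [pz|zx'] := between_split z xb.
    by have := level_le (reach_between rz pz); rewrite elx ltnn.
  by apply: (Gconvex Gzx') => //; exact: between_right.
have [yy'|y'y] : between (base y) y y' \/ between (base y) y' y.
  by apply: between_same_side; rewrite {2}eb.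
- exact: mid.
- by apply/Gsym/mid; rewrite -?eb -?el.
Qed.

Lemma block_bounded y : exists x, block y `<=` xsection G x.
Proof.
case: (posnP (level y)) => [l0|lgt0].
- exists (base y) => y' [eb el _]; apply/xsectionP.
  by have := reach_level y'; rewrite eb el l0.
- by exists y => y' ey; apply/xsectionP; exact: block_close.
Qed.

(** The levels of close points differ by at most 1, so that equal parity makes
    them equal.  If the sides differed, the base point would lie between two
    close points, and their level would be 0. *)
Lemma close_same_parity y y' : G (y, y') -> odd (level y) = odd (level y') ->
  block_key y = block_key y'.
Proof.
move=> Gyy' eodd; have eb := base_close Gyy'.
have el : level y = level y'.
  have := level_close Gyy'; have := level_close (Gsym Gyy').
  rewrite leq_eqVlt ltnS => /orP[/eqP e|le1].
    by move: eodd; rewrite e /=; case: (odd _).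
  rewrite leq_eqVlt ltnS => /orP[/eqP e|le2].
    by move: eodd; rewrite e /=; case: (odd _).
  by apply/eqP; rewrite eqn_leq le1.
rewrite /block_key -eb -el; congr (_, _, _).
case: (posnP (level y)) => //= lgt0; apply/eqP/negPn/negP.
move=> /between_opposite_sides ypy'.
have Gpy : G (base y, y) by apply: (Gconvex Gyy') => //; exact: between_left.
by have := @level_le 0 y Gpy; rewrite leqNgt lgt0.
Qed.

End ChainBlocks.

(** * The dimension bound *)

Lemma asdim_le1 (d : Order.disp_t) (X : orderType d) (C : coarse_structure X) :
  order_compatible C -> asdim_le C 1.
Proof.
move=> hC E CE; have [G [CG EG Gconvex Gsym]] := convex_entourage hC CE.
have Grefl x : G (x, x) by exact: entourage_refl CG.
pose lev := level Grefl; pose blk := block Grefl.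
have blk_self y : blk y y by [].
exists G => //; exists [set blk y | y in [set: X]]; split.
- by move=> _ [y _ <-]; exact: block_bounded.
- by apply/seteqP; split => // y _; exists (blk y) => //; exists y.
exists (fun i : 'I_2 => [set blk y | y in [set y | odd (lev y) = (i == 1 :> nat)]]).
split.
- apply/seteqP; split => [_ [y _ <-]|_ [i _ [y _ <-]]]; last by exists y.
  exists (inord (odd (lev y))) => //; exists y => //=.
  by rewrite inordK; case: (odd _).
- apply/trivIsetP => i j _ _ ij; apply/seteqP; split => // _ [[y /= oy <-]].
  move=> [y' /= oy' eyy'].
  have : blk y y' by rewrite -eyy'.
  move=> [_ el _]; move: oy'; rewrite /lev el -/(lev y) oy => eij.
  by case/eqP: ij; apply/val_inj; case: i j {oy} eij => [[|[|i]] ?] [[|[|j]] ?].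
- move=> i _ _ [y /= oy <-] [y' /= oy' <-] neq; apply/seteqP; split => // x.
  move=> [[a ay /xsectionP/EG Gax] xy'].
  apply: neq; rewrite /blk /block.
  rewrite -[block_key Grefl y]ay -[block_key Grefl y']xy'.
  rewrite (close_same_parity Gsym Gconvex Gax) //.
  by case: ay xy' => _ -> _ [_ -> _]; rewrite -/(lev y) -/(lev y') oy oy'.
Qed.

Theorem theorem2 (d : Order.disp_t) (X : orderType d) (C : coarse_structure X)
    (hconn : coarse_connected C) (hcomp : order_compatible C) :
  asdim C = Some 0 \/ asdim C = Some 1.
Proof.
rewrite /asdim; case: pselect => [ex_n|[]]; last first.
  by exists 1; apply/asboolP; exact: asdim_le1.
case: ex_minnP => n _ /(_ 1 (asboolT (asdim_le1 hcomp))).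
by case: n => [|[|n]] // _; [left|right].
Qed.
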